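(* Let $f:\mathbb R\to\mathbb R$ be $C^2$ and strictly convex with $f(0)=f'(0)=0$. Let $u_0<u_1\le0$. For $\varepsilon\in(0,1]$ let $\hat u^\varepsilon$ be the unique solution of $$\varepsilon \hat u^\varepsilon_{xx}=(f(\hat u^\varepsilon))_x\ \ (0<x<1),\qquad \hat u^\varepsilon(0)=u_0,\quad \hat u^\varepsilon(1)=u_1,$$ and let $v$ be the unique solution on $\mathbb R^+=[0,+\infty)$ of $$v''=(f(u_1+v))',\qquad v(0)=u_0-u_1,\qquad v(+\infty)=0.$$ Then there is a constant $C>0$, independent of $\varepsilon\in(0,1]$, such that for all $x\in[0,1]$: if $u_1<0$, $$\Big|\hat u^\varepsilon(x)-u_1-v\Big(\tfrac{x}{\varepsilon}\Big)\Big|\le C e^{f'(u_1)/\varepsilon},$$ whereas if $u_1=0$ and $f''(0)\neq0$, $$\Big|\hat u^\varepsilon(x)-v\Big(\tfrac{x}{\varepsilon}\Big)\Big|\le C\varepsilon .$$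
   Context: For every $\varepsilon>0$ and $u_0,u_1\in\mathbb R$ the boundary value problem for $\hat u^\varepsilon$ has a unique solution. *)

(* Defs.v *)
From Stdlib Require Import Reals.
From Coquelicot Require Import Coquelicot.
Open Scope R_scope.

Definition C2 (f : R -> R) : Prop :=
  forall x, ex_derive f x /\ ex_derive (Derive f) x /\ continuous (Derive_n f 2) x.

Definition strictly_convex (f : R -> R) : Prop :=
  forall x y t, x <> y -> 0 < t < 1 ->
    f (t * x + (1 - t) * y) < t * f x + (1 - t) * f y.

(** Functions on an interval are total functions on [R]; the values outside
    the interval are unconstrained.  Hence differentiability is only required at
    interior points and [continuous_on] (a limit taken within the set) is used
    at the end points. *)

(** [eps * u'' = (f(u))'] on [(0,1)], [u(0) = u0], [u(1) = u1]. *)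
Definition viscous_bvp_solution (f : R -> R) (u0 u1 eps : R) (u : R -> R) : Prop :=
  continuous_on (fun x => 0 <= x <= 1) u /\
  (forall x, 0 < x < 1 ->
     ex_derive u x /\ ex_derive (Derive u) x /\
     eps * Derive_n u 2 x = Derive (fun y => f (u y)) x) /\
  u 0 = u0 /\ u 1 = u1.

(** [v'' = (f(u1 + v))'] on the half-line, [v(0) = u0 - u1], [v(+oo) = 0]. *)
Definition layer_profile_solution (f : R -> R) (u0 u1 : R) (v : R -> R) : Prop :=
  continuous_on (fun x => 0 <= x) v /\
  (forall x, 0 < x ->
     ex_derive v x /\ ex_derive (Derive v) x /\
     Derive_n v 2 x = Derive (fun y => f (u1 + v y)) x) /\
  v 0 = u0 - u1 /\ is_lim v p_infty 0.

(* Main.v *)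
Require Import Defs.
From Stdlib Require Import Reals.
From Coquelicot Require Import Coquelicot.
From Stdlib Require Import Lra.
Open Scope R_scope.

(** In the stretched variable [y = x / eps], with [L = 1 / eps], both problems
    integrate once: [U' = f(U) - f(u1) + d] on [(0, L)] with a constant
    [d >= 0], and [w' = f(w) - f(u1)] for [w = u1 + v]; both solutions increase
    from [u0] and stay below [u1].  The difference [z = U - w] satisfies
    [z' = f(U) - f(w) + d], [z 0 = 0] and [z L = u1 - w L], and it is nonnegative.

    If [u1 < 0], put [a = - f'(u1) > 0].  Convexity gives [z' <= - a z + d],
    hence [z <= d / a]; and [z' >= f'(u0) z + d] gives
    [d <= (1 - f'(u0)) z L], where [z L = - v L <= (u1 - u0) exp (- a L)].

    If [u1 = 0] and [f''(0) > 0], then [f (- p) >= k p^2] on [[0, - u0]]; this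
    forces [d <= 4 / (k L^2)], and superadditivity of [f] on the negative axis
    gives [z' <= d - k z^2], hence [z <= sqrt (d / k) <= 2 / (k L)]. *)

(** * Monotonicity and barrier tests *)

Lemma nondecreasing_of_derive (F : R -> R) (a b : R) :
  a <= b -> (forall x, a <= x <= b -> continuous F x) ->
  (forall x, a < x < b -> exists l, is_derive F x l /\ 0 <= l) ->
  F a <= F b.
Proof.
  intros [Hab|<-] Hc Hd; [|apply Rle_refl].
  assert (pr : forall c, a < c < b -> derivable_pt F c).
  { intros c Hcab. apply ex_derive_Reals_0. destruct (Hd c Hcab) as [l [Hl _]].
    now exists l. }
  assert (pri : forall c, a < c < b -> derivable_pt id c)
    by (intros; apply derivable_pt_id).
  destruct (MVT F id a b pr pri Hab) as [c [P Heq]].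
  - intros c Hcab. now apply continuity_pt_filterlim, Hc.
  - intros c Hcab. apply derivable_continuous_pt, derivable_pt_id.
  - destruct (Hd c P) as [l [Hl Hl0]].
    rewrite (derive_pt_eq_0 F c l) in Heq by now apply is_derive_Reals.
    rewrite (derive_pt_eq_0 id c 1) in Heq by apply derivable_pt_lim_id.
    unfold id in Heq. nra.
Qed.

Lemma nonincreasing_of_derive (F : R -> R) (a b : R) :
  a <= b -> (forall x, a <= x <= b -> continuous F x) ->
  (forall x, a < x < b -> exists l, is_derive F x l /\ l <= 0) ->
  F b <= F a.
Proof.
  intros Hab Hc Hd.
  apply Ropp_le_cancel, (nondecreasing_of_derive (fun x => - F x)); trivial.
  - intros x Hx. apply (continuous_opp F), Hc, Hx.
  - intros x Hx. destruct (Hd x Hx) as [l [Hl Hl0]].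
    exists (- l). split; [apply (is_derive_opp F x l Hl)|lra].
Qed.

(** Past the last point [s] of the interval with [F s <= B], the function stays above [B], so there
    it is nonincreasing and ends no higher than [F s]. Asking for a sign of the derivative only
    above the level [B] is what lets differential inequalities be used. *)
Lemma barrier_le (F : R -> R) (a b B : R) :
  a <= b -> (forall x, a <= x <= b -> continuous F x) -> F a <= B ->
  (forall x, a < x < b -> B < F x -> exists l, is_derive F x l /\ l <= 0) ->
  F b <= B.
Proof.
  intros Hab Hc Ha Hd.
  apply Rnot_lt_le; intros Hb.
  destruct (completeness (fun s => a <= s <= b /\ F s <= B)) as [s [Hub Hlub]].
  { exists b. intros s [Hs _]. lra. }
  { exists a. split; [lra|easy]. }
  assert (Has : a <= s) by (apply Hub; split; [lra|easy]).
  assert (Hsb : s <= b) by (apply Hlub; intros t [Ht _]; lra).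
  assert (Hs : F s <= B).
  { apply Rnot_lt_le; intros Hs.
    destruct (Hc s (conj Has Hsb) _ (open_gt B (F s) Hs)) as [d Hnear].
    (* If [F s > B], continuity keeps [F > B] just left of [s], so [s - d / 2] would be a smaller
       upper bound. *)
    assert (s <= s - d / 2); [|pose proof (cond_pos d); lra].
    apply Hlub. intros t [Ht HFt].
    apply Rnot_lt_le; intros Hts.
    assert (t <= s) by (apply Hub; now split).
    apply (Rlt_not_le _ _ (Hnear t ltac:(
      change (Rabs (t - s) < d); apply Rabs_def1; pose proof (cond_pos d); lra))), HFt. }
  assert (Hgt : forall x, s < x <= b -> B < F x).
  { intros x Hx. apply Rnot_le_lt; intros HFx.
    assert (x <= s) by (apply Hub; split; [lra|easy]). lra. }
  assert (F b <= F s); [|lra].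
  apply nonincreasing_of_derive; trivial.
  - intros x Hx. apply Hc. lra.
  - intros x Hx. apply Hd; [lra|]. apply Hgt. lra.
Qed.

(** * Continuous extension from an interval to the line *)

(** The clamp is 1-Lipschitz with values in [[0, L]], so continuity within the interval suffices.
    The extension agrees with [u] there and makes the derivative tests usable up to the end
    points. *)
Lemma continuous_clamp (u : R -> R) (L x : R) :
  0 <= L -> continuous_on (fun x => 0 <= x <= L) u ->
  continuous (fun x => u (Rmax 0 (Rmin x L))) x.
Proof.
  intros HL Hu.
  set (cl := fun x => Rmax 0 (Rmin x L)).
  assert (Hcl : forall y, 0 <= cl y <= L).
  { intros y. unfold cl. split; [apply Rmax_l|].
    apply Rmax_lub; [easy|apply Rmin_r]. }
  intros P HP.
  destruct (Hu (cl x) (Hcl x) P HP) as [d Hd].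
  exists d. intros y Hy.
  apply (Hd (cl y)); [|apply Hcl].
  change (Rabs (y - x) < d) in Hy. change (Rabs (cl y - cl x) < d).
  apply Rle_lt_trans with (2 := Hy).
  unfold cl, Rmax, Rmin.
  repeat destruct Rle_dec; unfold Rabs; repeat destruct Rcase_abs; lra.
Qed.

Lemma continuous_clamp_half_line (u : R -> R) (x : R) :
  continuous_on (fun x => 0 <= x) u -> continuous (fun x => u (Rmax 0 x)) x.
Proof.
  intros Hu P HP.
  destruct (Hu (Rmax 0 x) (Rmax_l 0 x) P HP) as [d Hd].
  exists d. intros y Hy.
  apply (Hd (Rmax 0 y)); [|apply Rmax_l].
  change (Rabs (y - x) < d) in Hy. change (Rabs (Rmax 0 y - Rmax 0 x) < d).
  apply Rle_lt_trans with (2 := Hy).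
  unfold Rmax.
  repeat destruct Rle_dec; unfold Rabs; repeat destruct Rcase_abs; lra.
Qed.

Lemma locally_between (a b x : R) : a < x < b -> locally x (fun y => a < y < b).
Proof.
  intros [Ha Hb].
  apply filter_and; [apply (open_gt a x Ha)|apply (open_lt b x Hb)].
Qed.

(** * First integral and sign of the speed for a scalar autonomous equation *)

Lemma first_integral_constant (f u : R -> R) (L eps : R) :
  (forall s, ex_derive f s) ->
  (forall x, 0 < x < L -> ex_derive u x /\ ex_derive (Derive u) x /\
     eps * Derive_n u 2 x = Derive (fun y => f (u y)) x) ->
  forall a b, 0 < a < L -> 0 < b < L ->
    eps * Derive u a - f (u a) = eps * Derive u b - f (u b).
Proof.
  intros Hf Hu.
  set (G := fun x => eps * Derive u x - f (u x)).
  assert (HG : forall x, 0 < x < L -> is_derive G x 0).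
  { intros x Hx. destruct (Hu x Hx) as [H1 [H2 H3]].
    change (Derive_n u 2 x) with (Derive (Derive u) x) in H3.
    assert (Hfu : ex_derive (fun y => f (u y)) x)
      by (apply (ex_derive_comp f u x); [apply Hf|easy]).
    replace 0 with (eps * Derive (Derive u) x - Derive (fun y => f (u y)) x)
      by (rewrite <- H3; ring).
    apply (is_derive_minus (fun x => eps * Derive u x)).
    - apply (is_derive_scal (Derive u)). now apply Derive_correct.
    - now apply Derive_correct. }
  assert (Hle : forall a b, 0 < a < L -> 0 < b < L -> a <= b -> G a = G b).
  { intros a b Ha Hb Hab.
    assert (Hc : forall x, a <= x <= b -> continuous G x).
    { intros x Hx. apply (ex_derive_continuous G). exists 0. apply HG. lra. }
    apply Rle_antisym;
      [apply nondecreasing_of_derive|apply nonincreasing_of_derive]; trivial;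
      intros x Hx; exists 0; (split; [apply HG; lra|lra]). }
  intros a b Ha Hb. change (G a = G b).
  destruct (Rle_dec a b); [|symmetry]; apply Hle; lra.
Qed.

(* Gronwall for [h^2], which unlike [h] needs no sign information. *)
Lemma nonvanishing_of_linear_ode (h b : R -> R) (a c B : R) :
  (forall x, a < x < c -> is_derive h x (b x * h x)) ->
  (forall x, a < x < c -> Rabs (b x) <= B) ->
  forall x y, a < x < c -> a < y < c -> h x <> 0 -> h y <> 0.
Proof.
  intros Hh Hb x y Hx Hy Hhx Hhy.
  (* The weight [exp (e * t)] shifts the rate [2 * b t] by [e]: [e = 2 * B] makes the product
     nondecreasing and carries positivity to the right, [e = - 2 * B] carries it to the left. *)
  assert (Hd : forall e t, a < t < c ->
    is_derive (fun t => h t * h t * exp (e * t)) t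
      (2 * (b t + e / 2) * (h t * h t * exp (e * t)))).
  { intros e t Ht. auto_derive.
    - repeat split; exists (b t * h t); now apply Hh.
    - change (fun x0 => h x0) with h.
      rewrite (is_derive_unique _ _ _ (Hh t Ht)). field. }
  assert (Hc : forall e t, a < t < c ->
    continuous (fun t => h t * h t * exp (e * t)) t).
  { intros e t Ht.
    apply (ex_derive_continuous (fun t => h t * h t * exp (e * t))).
    eexists. now apply Hd. }
  assert (Hpos : forall e t, 0 <= h t * h t * exp (e * t)).
  { intros e t. apply Rmult_le_pos; [nra|apply Rlt_le, exp_pos]. }
  assert (Hlt : forall e, 0 < h x * h x * exp (e * x)).
  { intros e. apply Rmult_lt_0_compat; [nra|apply exp_pos]. }
  destruct (Rle_dec x y) as [Hxy|Hxy].
  - assert (H : h x * h x * exp (2 * B * x) <= h y * h y * exp (2 * B * y)).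
    { apply (nondecreasing_of_derive (fun t => h t * h t * exp (2 * B * t)));
        [lra|intros t Ht; apply Hc; lra|].
      intros t Ht. eexists. split; [apply Hd; lra|].
      apply Rmult_le_pos; [|apply Hpos].
      assert (Hbt := Hb t ltac:(lra)). apply Rabs_le_between in Hbt. lra. }
    rewrite Hhy in H. specialize (Hlt (2 * B)). lra.
  - assert (H : h x * h x * exp (- 2 * B * x) <= h y * h y * exp (- 2 * B * y)).
    { apply (nonincreasing_of_derive (fun t => h t * h t * exp (- 2 * B * t)));
        [lra|intros t Ht; apply Hc; lra|].
      intros t Ht. eexists. split; [apply Hd; lra|].
      assert (Hbt := Hb t ltac:(lra)). apply Rabs_le_between in Hbt.
      pose proof (Hpos (- 2 * B) t). nra. }
    rewrite Hhy in H. specialize (Hlt (- 2 * B)). lra.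
Qed.

(** The speed [h = f(u) + k] solves the linear equation [h' = f'(u) h] with bounded coefficient, so
    once nonzero it never vanishes and keeps its sign. Since [u] rises overall, [h] is positive
    somewhere. *)
Lemma positive_speed (f u : R -> R) (L k : R) :
  0 < L -> (forall s, ex_derive f s) -> (forall s, continuous (Derive f) s) ->
  (forall x, continuous u x) ->
  (forall x, 0 < x < L -> is_derive u x (f (u x) + k)) ->
  u 0 < u L ->
  forall x, 0 < x < L -> 0 < f (u x) + k.
Proof.
  intros HL Hf Hf' Hc Hu H0L.
  assert (Hfc : forall x, continuous (fun x => Rabs (Derive f (u x))) x).
  { intros x. apply (continuous_comp (fun x => Derive f (u x)) Rabs);
      [apply (continuous_comp u (Derive f)); [apply Hc|apply Hf']|].
    apply (continuous_Rabs (Derive f (u x))). }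
  destruct (continuity_ab_maj (fun x => Rabs (Derive f (u x))) 0 L) as [m [Hm _]].
  { lra. }
  { intros x _. apply continuity_pt_filterlim, Hfc. }
  set (h := fun x => f (u x) + k).
  assert (Hh : forall x, 0 < x < L -> is_derive h x (Derive f (u x) * h x)).
  { intros x Hx. unfold h. auto_derive.
    - repeat split; [apply Hf|]. eexists; now apply Hu.
    - change (fun x0 => u x0) with u. change (fun x0 => f x0) with f.
      rewrite (is_derive_unique _ _ _ (Hu x Hx)). ring. }
  assert (Hex : exists x0, 0 < x0 < L /\ 0 < h x0).
  { apply Classical_Prop.NNPP; intros Hno.
    assert (u L <= u 0); [|lra].
    apply nonincreasing_of_derive; [lra|intros; apply Hc|].
    intros x Hx. exists (h x). split; [now apply Hu|].
    apply Rnot_lt_le; intros Hpos. apply Hno. now exists x. }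
  destruct Hex as [x0 [Hx0 Hpos]].
  intros x Hx. change (0 < h x).
  assert (Hnz : forall y, 0 < y < L -> h y <> 0).
  { intros y Hy.
    apply (nonvanishing_of_linear_ode h (fun x => Derive f (u x)) 0 L
             (Rabs (Derive f (u m))) Hh) with x0; trivial; [|lra].
    intros t Ht. apply Hm. lra. }
  apply Rnot_le_lt; intros Hneg.
  assert (Hhc : forall y, continuity_pt h y).
  { intros y. apply continuity_pt_filterlim.
    apply (continuous_plus (fun x => f (u x)) (fun _ => k));
      [|apply continuous_const].
    apply (continuous_comp u f); [apply Hc|].
    apply (ex_derive_continuous f), Hf. }
  destruct (IVT_gen h x x0 0 Hhc) as [y [Hy Hy0]].
  { unfold Rmin, Rmax; destruct Rle_dec; lra. }
  apply (Hnz y); trivial.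
  revert Hy. unfold Rmin, Rmax; destruct Rle_dec; lra.
Qed.

(** * Tangent lines of convex functions *)

Lemma convex_tangent_le (f : R -> R) (x y : R) :
  (forall s, ex_derive f s) -> strictly_convex f ->
  f x + Derive f x * (y - x) <= f y.
Proof.
  intros Hf Hconv.
  destruct (Req_dec y x) as [->|Hne]; [lra|].
  (* Convexity gives [g t < g 0] on [(0, 1)], whereas a failing tangent inequality would give [g] a
     positive slope at 0. Using this slope as the tolerance keeps the difference quotient
     positive. *)
  set (g := fun t => f (x + t * (y - x)) - t * (f y - f x)).
  assert (Hg : is_derive g 0 (Derive f x * (y - x) - (f y - f x))).
  { unfold g. auto_derive.
    - repeat split. apply Hf.
    - change (fun x0 => f x0) with f.
      replace (x + 0 * (y - x)) with x by ring. ring. }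
  apply Rnot_lt_le; intros Hlt.
  apply is_derive_Reals in Hg.
  destruct (Hg (Derive f x * (y - x) - (f y - f x)) ltac:(lra)) as [d Hd].
  set (t := Rmin (d / 2) (1 / 2)).
  assert (Ht : 0 < t /\ t <= d / 2 /\ t <= 1 / 2).
  { pose proof (cond_pos d). unfold t. repeat split;
      [apply Rmin_glb_lt; lra|apply Rmin_l|apply Rmin_r]. }
  specialize (Hd t ltac:(lra) ltac:(rewrite Rabs_pos_eq; lra)).
  apply Rabs_def2 in Hd as [_ Hd].
  assert (Hgt : g (0 + t) - g 0 < 0).
  { unfold g. specialize (Hconv y x t Hne ltac:(lra)).
    replace (x + (0 + t) * (y - x)) with (t * y + (1 - t) * x) by ring.
    replace (x + 0 * (y - x)) with x by ring. nra. }
  assert ((g (0 + t) - g 0) / t < 0); [|lra].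
  apply Rdiv_neg_pos; lra.
Qed.

Lemma convex_derive_le (f : R -> R) (x y : R) :
  (forall s, ex_derive f s) -> strictly_convex f ->
  x <= y -> Derive f x <= Derive f y.
Proof.
  intros Hf Hconv [Hxy|<-]; [|apply Rle_refl].
  pose proof (convex_tangent_le f x y Hf Hconv).
  pose proof (convex_tangent_le f y x Hf Hconv). nra.
Qed.

(** * The convex flux with its minimum at 0 *)

Section ConvexFlux.

Variable f : R -> R.
Hypothesis f_C2 : C2 f.
Hypothesis f_convex : strictly_convex f.
Hypothesis f_0 : f 0 = 0.
Hypothesis f'_0 : Derive f 0 = 0.

Lemma flux_ex_derive s : ex_derive f s.
Proof. apply f_C2. Qed.

Lemma flux_continuous s : continuous f s.
Proof. apply (ex_derive_continuous f), flux_ex_derive. Qed.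

Lemma flux_continuous_Derive s : continuous (Derive f) s.
Proof. apply (ex_derive_continuous (Derive f)), f_C2. Qed.

Lemma flux_tangent_le x y : f x + Derive f x * (y - x) <= f y.
Proof. apply convex_tangent_le; [apply flux_ex_derive|easy]. Qed.

Lemma flux_Derive_le x y : x <= y -> Derive f x <= Derive f y.
Proof. apply convex_derive_le; [apply flux_ex_derive|easy]. Qed.

Lemma flux_ge_0 x : 0 <= f x.
Proof. pose proof (flux_tangent_le 0 x). rewrite f_0, f'_0 in H. lra. Qed.

Lemma flux_decreasing x y : x <= y -> y <= 0 -> f y <= f x.
Proof.
  intros Hxy Hy. pose proof (flux_tangent_le y x).
  pose proof (flux_Derive_le y 0 Hy). rewrite f'_0 in H0. nra.
Qed.

(** If [f'(x) = 0], the tangent at [x] gives [f x <= 0], and strict convexity makes [f] negative at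
    the midpoint of [x] and 0, against [f >= 0]. *)
Lemma flux_Derive_neg x : x < 0 -> Derive f x < 0.
Proof.
  intros Hx.
  pose proof (flux_Derive_le x 0 ltac:(lra)) as [H|H]; [lra|].
  exfalso. rewrite f'_0 in H.
  pose proof (flux_tangent_le x 0) as H0. rewrite H, f_0 in H0.
  pose proof (f_convex x 0 (1 / 2) ltac:(lra) ltac:(lra)) as H1.
  rewrite f_0 in H1.
  pose proof (flux_ge_0 (1 / 2 * x + (1 - 1 / 2) * 0)). lra.
Qed.

(** On [[- (p + q), 0]] the graph lies below the chord ending at the origin; the chord values at
    [- p] and [- q] add up to [f (- (p + q))]. *)
Lemma flux_superadditive p q :
  0 < p -> 0 < q -> f (- p) + f (- q) <= f (- (p + q)).
Proof.
  intros Hp Hq.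
  assert (H : forall r s, 0 < r -> 0 < s ->
    f (- r) < r / (r + s) * f (- (r + s))).
  { intros r s Hr Hs.
    assert (Ht : 0 < r / (r + s) < 1).
    { split; [apply Rdiv_lt_0_compat; lra|].
      apply Rlt_div_l; lra. }
    pose proof (f_convex (- (r + s)) 0 (r / (r + s)) ltac:(lra) Ht) as H.
    rewrite f_0 in H.
    replace (r / (r + s) * - (r + s) + (1 - r / (r + s)) * 0) with (- r) in H
      by (field; lra). lra. }
  pose proof (H p q Hp Hq). pose proof (H q p Hq Hp).
  rewrite (Rplus_comm q p) in H1.
  replace (f (- (p + q)))
    with (p / (p + q) * f (- (p + q)) + q / (p + q) * f (- (p + q)))
    by (field; lra). lra.
Qed.

Lemma flux_quadratic_lower_bound P :
  0 < P -> Derive_n f 2 0 <> 0 ->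
  exists k, 0 < k /\ forall p, 0 <= p <= P -> k * p ^ 2 <= f (- p).
Proof.
  intros HP Hne.
  set (c := Derive_n f 2 0) in *.
  assert (Hd : is_derive (Derive f) 0 c) by apply Derive_correct, f_C2.
  apply is_derive_Reals in Hd.
  (* Were [c] negative, difference quotients of [f'] at 0 would be negative too, against the
     monotonicity of [f']. *)
  assert (Hc : 0 < c).
  { apply Rnot_le_lt; intros Hc.
    destruct (Hd (- c) ltac:(lra)) as [d Hd'].
    pose proof (cond_pos d).
    specialize (Hd' (d / 2) ltac:(lra) ltac:(rewrite Rabs_pos_eq; lra)).
    apply Rabs_def2 in Hd' as [Hd' _].
    assert (0 <= (Derive f (0 + d / 2) - Derive f 0) / (d / 2)); [|lra].
    apply Rdiv_le_0_compat; [|lra].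
    pose proof (flux_Derive_le 0 (0 + d / 2) ltac:(lra)). lra. }
  destruct (Hd (c / 2) ltac:(lra)) as [d Hd'].
  set (r := Rmin d P).
  assert (Hr : 0 < r /\ r <= d /\ r <= P).
  { pose proof (cond_pos d). unfold r. repeat split;
      [apply Rmin_glb_lt; lra|apply Rmin_l|apply Rmin_r]. }
  assert (Hf' : forall s, 0 < s < r -> Derive f (- s) <= - (c / 2) * s).
  { intros s Hs.
    specialize (Hd' (- s) ltac:(lra)
      ltac:(rewrite Rabs_Ropp, Rabs_pos_eq; lra)).
    apply Rabs_def2 in Hd' as [_ Hd'].
    rewrite f'_0, Rplus_0_l in Hd'.
    assert (Hq : c / 2 < - Derive f (- s) / s)
      by (replace (- Derive f (- s) / s) with ((Derive f (- s) - 0) / - s)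
            by (field; lra); lra).
    apply Rlt_div_r in Hq; lra. }
  (* Tangent at the midpoint [- p / 2]. *)
  assert (Hsmall : forall p, 0 <= p <= r -> c / 8 * p ^ 2 <= f (- p)).
  { intros p [[Hp|<-] Hpr]; [|pose proof (flux_ge_0 (- 0)); lra].
    pose proof (flux_tangent_le (- (p / 2)) (- p)).
    pose proof (flux_ge_0 (- (p / 2))).
    pose proof (Hf' (p / 2) ltac:(lra)). nra. }
  (* The bound with [c / 8] holds on [[0, r]]. Beyond [r] only [f (- p) >= f (- r)] is used; the
     factor [(r / P) ^ 2] brings [p ^ 2 <= P ^ 2] down to [r ^ 2]. *)
  exists (c / 8 * (r / P) ^ 2).
  assert (HrP : 0 < r / P <= 1).
  { split; [apply Rdiv_lt_0_compat; lra|apply Rle_div_l; lra]. }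
  split; [apply Rmult_lt_0_compat; [lra|apply pow_lt; lra]|].
  intros p Hp.
  destruct (Rle_dec p r) as [Hpr|Hpr].
  - apply Rle_trans with (2 := Hsmall p ltac:(lra)).
    apply Rmult_le_compat_r; [apply pow2_ge_0|].
    assert ((r / P) ^ 2 <= 1 ^ 2) by (apply pow_incr; lra). nra.
  - apply Rle_trans with (2 := flux_decreasing (- p) (- r) ltac:(lra) ltac:(lra)).
    apply Rle_trans with (2 := Hsmall r ltac:(lra)).
    rewrite Rmult_assoc, <- Rpow_mult_distr.
    apply Rmult_le_compat_l; [lra|].
    apply pow_incr. split; [apply Rmult_le_pos; lra|].
    replace r with (r / P * P) at 2 by (field; lra).
    apply Rmult_le_compat_l; lra.
Qed.

(** * First integrals and monotonicity of the two profiles *)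

Variables u0 u1 : R.
Hypothesis u0_lt_u1 : u0 < u1.
Hypothesis u1_le_0 : u1 <= 0.

Lemma increasing_of_positive_speed (u : R -> R) (a b k : R) :
  a < b -> (forall x, continuous u x) ->
  (forall x, a < x < b -> is_derive u x (f (u x) + k)) ->
  (forall x, a < x < b -> 0 < f (u x) + k) ->
  forall x y, a <= x -> x <= y -> y <= b -> u x <= u y.
Proof.
  intros Hab Hc Hu Hpos x y Hax Hxy Hyb.
  apply nondecreasing_of_derive; trivial.
  intros t Ht. exists (f (u t) + k).
  split; [apply Hu|apply Rlt_le, Hpos]; lra.
Qed.

(** [U] is the clamped solution in the stretched variable, and [d] is the value of its speed at the
    right end, where [U = u1]; as a limit of positive speeds it is nonnegative. *)
Lemma viscous_first_integral (eps : R) (u : R -> R) :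
  0 < eps -> viscous_bvp_solution f u0 u1 eps u ->
  exists (U : R -> R) (d : R),
    0 <= d /\ (forall y, continuous U y) /\ U 0 = u0 /\ U (/ eps) = u1 /\
    (forall y, 0 <= y <= / eps -> U y = u (eps * y)) /\
    (forall y, 0 < y < / eps -> is_derive U y (f (U y) + (d - f u1))) /\
    (forall y, 0 <= y <= / eps -> u0 <= U y <= u1) /\
    (forall y, 0 <= y < / eps -> U y < u1).
Proof.
  intros Heps [Hcont [Hode [Hu0 Hu1]]].
  assert (HL : 0 < / eps) by now apply Rinv_0_lt_compat.
  assert (HeL : eps * / eps = 1) by (field; lra).
  set (cu := fun x => u (Rmax 0 (Rmin x 1))).
  set (U := fun y => cu (eps * y)).
  (* The constant of integration, read off at an arbitrary interior point. *)
  set (k := eps * Derive u (1 / 2) - f (u (1 / 2))).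
  assert (Hcl : forall x, 0 <= x <= 1 -> cu x = u x).
  { intros x Hx. unfold cu. rewrite Rmin_left, Rmax_right; [easy|lra..]. }
  assert (HUu : forall y, 0 <= y <= / eps -> U y = u (eps * y)).
  { intros y Hy. apply Hcl. nra. }
  assert (Hin : forall y, 0 < y < / eps -> 0 < eps * y < 1) by (intros; nra).
  assert (HUc : forall y, continuous U y).
  { intros y. apply (continuous_comp (fun y => eps * y) cu).
    - apply (continuous_mult (fun _ => eps) (fun y => y));
        [apply continuous_const|apply continuous_id].
    - apply continuous_clamp; [lra|easy]. }
  assert (HUd : forall y, 0 < y < / eps -> is_derive U y (f (U y) + k)).
  { intros y Hy. specialize (Hin y Hy).
    apply (is_derive_ext_loc (fun y => u (eps * y))).
    { apply filter_imp with (2 := locally_between 0 (/ eps) y Hy).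
      intros t Ht. symmetry. apply HUu. lra. }
    rewrite HUu by lra.
    replace (f (u (eps * y)) + k) with (eps * Derive u (eps * y)).
    2: { pose proof (first_integral_constant f u 1 eps flux_ex_derive Hode
           (eps * y) (1 / 2) Hin ltac:(lra)). unfold k. lra. }
    auto_derive; [repeat split; now apply Hode|].
    change (fun x => u x) with u. ring. }
  assert (HU0 : U 0 = u0) by (rewrite HUu, Rmult_0_r; [easy|lra]).
  assert (HU1 : U (/ eps) = u1) by (rewrite HUu, HeL; [easy|lra]).
  assert (Hpos : forall y, 0 < y < / eps -> 0 < f (U y) + k).
  { apply (positive_speed f U (/ eps) k); trivial.
    - apply flux_ex_derive.
    - apply flux_continuous_Derive.
    - lra. }
  assert (Hmono := increasing_of_positive_speed U 0 (/ eps) k HL HUc HUd Hpos).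
  assert (Hk : 0 <= k + f u1).
  { apply Rnot_lt_le; intros Hneg.
    assert (Hgc : continuous (fun y => f (U y) + k) (/ eps)).
    { apply (continuous_plus (fun y => f (U y)) (fun _ => k));
        [|apply continuous_const].
      apply (continuous_comp U f); [apply HUc|apply flux_continuous]. }
    assert (Hg : f (U (/ eps)) + k < 0) by (rewrite HU1; lra).
    destruct (Hgc _ (open_lt 0 _ Hg)) as [r Hr].
    pose proof (cond_pos r).
    set (t := Rmin (r / 2) (/ eps / 2)).
    assert (Ht : 0 < t /\ t <= r / 2 /\ t <= / eps / 2).
    { unfold t. repeat split;
        [apply Rmin_glb_lt; lra|apply Rmin_l|apply Rmin_r]. }
    assert (f (U (/ eps - t)) + k < 0).
    { apply Hr. change (Rabs (/ eps - t - / eps) < r). apply Rabs_def1; lra. }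
    pose proof (Hpos (/ eps - t) ltac:(lra)). lra. }
  exists U, (k + f u1).
  assert (Hrange : forall y, 0 <= y <= / eps -> u0 <= U y <= u1).
  { intros y Hy. rewrite <- HU0, <- HU1. split; apply Hmono; lra. }
  refine (conj _ (conj HUc (conj HU0 (conj HU1 (conj HUu (conj _ (conj Hrange _))))))).
  - lra.
  - intros y Hy. replace (k + f u1 - f u1) with k by ring. now apply HUd.
  - intros y Hy. apply Rnot_le_lt; intros Hge.
    set (m := (y + / eps) / 2). assert (Hm : 0 < m < / eps) by (unfold m; lra).
    (* [U] would be constant on [[y, / eps]], against its positive speed. *)
    assert (Hflat : is_derive U m 0).
    { apply (is_derive_ext_loc (fun _ => u1)); [|apply is_derive_Reals, derivable_pt_lim_const].
      apply filter_imp with (2 := locally_between y (/ eps) m ltac:(unfold m; lra)).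
      intros t Ht. apply Rle_antisym.
      - apply Rle_trans with (1 := Hge). apply Hmono; lra.
      - apply Hrange. lra. }
    pose proof (is_derive_unique _ _ _ Hflat) as E1.
    rewrite (is_derive_unique _ _ _ (HUd m Hm)) in E1.
    pose proof (Hpos m Hm). lra.
Qed.

(** The limit at infinity fixes the constant of integration: the speed tends to [f u1 + k], which
    must vanish for an increasing profile that converges to [u1]. *)
Lemma layer_first_integral (v : R -> R) :
  layer_profile_solution f u0 u1 v ->
  exists w : R -> R,
    (forall y, continuous w y) /\ w 0 = u0 /\
    (forall y, 0 <= y -> w y = u1 + v y) /\
    (forall y, 0 < y -> is_derive w y (f (w y) - f u1)) /\
    (forall y, 0 <= y -> u0 <= w y <= u1).
Proof.
  intros [Hcont [Hode [Hv0 Hlim]]].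
  set (w := fun y => u1 + v (Rmax 0 y)).
  set (w' := fun y => u1 + v y).
  set (k := 1 * Derive w' 1 - f (w' 1)).
  assert (Hww : forall y, 0 <= y -> w y = w' y).
  { intros y Hy. unfold w, w'. now rewrite Rmax_right. }
  assert (Hwc : forall y, continuous w y).
  { intros y. apply (continuous_plus (fun _ => u1) (fun y => v (Rmax 0 y)));
      [apply continuous_const|now apply continuous_clamp_half_line]. }
  assert (HD : forall y, Derive w' y = Derive v y).
  { intros y. unfold w', Derive. f_equal. apply Lim_ext. intros t. f_equal. ring. }
  assert (Hode' : forall L x, 0 < x < L -> ex_derive w' x /\
    ex_derive (Derive w') x /\ 1 * Derive_n w' 2 x = Derive (fun y => f (w' y)) x).
  { intros L x Hx. destruct (Hode x ltac:(lra)) as [H1 [H2 H3]]. repeat split.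
    - apply (ex_derive_plus (fun _ => u1) v); [apply ex_derive_const|easy].
    - apply ex_derive_ext with (2 := H2). intros t. symmetry. apply HD.
    - rewrite Rmult_1_l. unfold w' at 2. rewrite <- H3.
      change (Derive (Derive w') x = Derive (Derive v) x).
      apply Derive_ext, HD. }
  assert (Hwd : forall y, 0 < y -> is_derive w y (f (w y) + k)).
  { intros y Hy.
    apply (is_derive_ext_loc w').
    { apply filter_imp with (2 := locally_between 0 (y + 1) y ltac:(lra)).
      intros t Ht. symmetry. apply Hww. lra. }
    rewrite Hww by lra.
    replace (f (w' y) + k) with (Derive w' y).
    2: { pose proof (first_integral_constant f w' (y + 2) 1 flux_ex_derive
           (Hode' (y + 2)) y 1 ltac:(lra) ltac:(lra)). unfold k. lra. }
    apply Derive_correct. apply (Hode' (y + 1)); lra. }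
  assert (Hw0 : w 0 = u0) by (rewrite Hww by lra; unfold w'; lra).
  assert (Htail : forall e, 0 < e -> exists Y, 0 < Y /\
    forall y, Y < y -> u1 - e < w y < u1 + e).
  { intros e He.
    apply is_lim_spec in Hlim. destruct (Hlim (mkposreal e He)) as [M HM].
    exists (Rmax 1 M). split; [apply Rlt_le_trans with (2 := Rmax_l 1 M); lra|].
    intros y Hy. pose proof (Rmax_l 1 M). pose proof (Rmax_r 1 M).
    rewrite (Hww y) by lra. unfold w'.
    specialize (HM y ltac:(lra)). simpl in HM. rewrite Rminus_0_r in HM.
    apply Rabs_def2 in HM. lra. }
  assert (Hpos : forall y, 0 < y -> 0 < f (w y) + k).
  { intros y Hy.
    (* With tolerance [u1 - u0] the tail lies above [u0], which supplies the overall rise on a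
       bounded interval containing [y]. *)
    destruct (Htail (u1 - u0) ltac:(lra)) as [Y [HY0 HY]].
    apply (positive_speed f w (Y + y + 1) k); trivial; try lra.
    - apply flux_ex_derive.
    - apply flux_continuous_Derive.
    - intros x Hx. apply Hwd. lra.
    - rewrite Hw0. specialize (HY (Y + y + 1)). lra. }
  assert (Hmono : forall x y, 0 <= x -> x <= y -> w x <= w y).
  { intros x y Hx Hxy.
    apply (increasing_of_positive_speed w 0 (y + 1) k); trivial; try lra;
      intros t Ht; [apply Hwd|apply Hpos]; lra. }
  assert (Hle : forall y, 0 <= y -> w y <= u1).
  { intros y Hy. apply Rnot_lt_le; intros Hlt.
    destruct (Htail (w y - u1) ltac:(lra)) as [Y [HY0 HY]].
    specialize (HY (Y + y + 1) ltac:(lra)).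
    pose proof (Hmono y (Y + y + 1) Hy ltac:(lra)). lra. }
  assert (Hk : k = - f u1).
  { apply Rle_antisym; apply Rnot_lt_le; intros Hlt.
    - (* The speed is at least [k + f u1 > 0], so [w] would be unbounded. *)
      set (m := k + f u1). assert (Hm : 0 < m) by (unfold m; lra).
      (* By time [Y] the rise is at least [m * Y = u1 - u0 + m], more than the room below [u1]. *)
      set (Y := (u1 - u0) / m + 1).
      assert (HY : 0 < Y).
      { unfold Y. pose proof (Rdiv_lt_0_compat (u1 - u0) m). lra. }
      assert (H : w 0 - m * 0 <= w Y - m * Y).
      { apply (nondecreasing_of_derive (fun y => w y - m * y)); [lra| |].
        - intros x _. apply (continuous_minus w (fun y => m * y)); [apply Hwc|].
          apply (continuous_mult (fun _ => m) (fun y => y));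
            [apply continuous_const|apply continuous_id].
        - intros x Hx. exists (f (w x) + k - m). split.
          + apply (is_derive_minus w); [apply Hwd; lra|].
            auto_derive; [easy|ring].
          + pose proof (flux_decreasing (w x) u1 (Hle x ltac:(lra)) u1_le_0).
            unfold m. lra. }
      assert (m * Y = u1 - u0 + m) by (unfold Y; field; lra).
      pose proof (Hle Y ltac:(lra)). lra.
    (* Here the speed would be negative once [w] is close to [u1]. *)
    - assert (Hg : f u1 < - k) by lra.
      destruct (flux_continuous u1 _ (open_lt (- k) _ Hg)) as [r Hr].
      destruct (Htail r (cond_pos r)) as [Y [HY0 HY]].
      specialize (HY (Y + 1) ltac:(lra)).
      assert (f (w (Y + 1)) < - k).
      { apply Hr. change (Rabs (w (Y + 1) - u1) < r). apply Rabs_def1; lra. }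
      pose proof (Hpos (Y + 1) ltac:(lra)). lra. }
  exists w. refine (conj Hwc (conj Hw0 (conj Hww (conj _ _)))).
  - intros y Hy. replace (f (w y) - f u1) with (f (w y) + k) by (rewrite Hk; ring).
    now apply Hwd.
  - intros y Hy. split; [|now apply Hle]. rewrite <- Hw0. apply Hmono; lra.
Qed.

(** The tangent at [u1] gives [(u1 - w)' <= f'(u1) (u1 - w)]; multiply by the integrating factor
    [exp (- a * y)]. *)
Lemma layer_exponential_decay (w : R -> R) (y : R) :
  (forall y, continuous w y) -> w 0 = u0 ->
  (forall y, 0 < y -> is_derive w y (f (w y) - f u1)) ->
  0 <= y -> u1 - w y <= (u1 - u0) * exp (Derive f u1 * y).
Proof.
  intros Hwc Hw0 Hwd Hy.
  set (a := Derive f u1).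
  assert (H : (u1 - w y) * exp (- a * y) <= (u1 - w 0) * exp (- a * 0)).
  { assert (Hd : forall x, 0 < x -> is_derive (fun y => (u1 - w y) * exp (- a * y)) x
      ((f u1 - f (w x) - a * (u1 - w x)) * exp (- a * x))).
    { intros x Hx. auto_derive.
      - repeat split. eexists. now apply Hwd.
      - change (fun x => w x) with w.
        rewrite (is_derive_unique _ _ _ (Hwd x Hx)). ring. }
    apply (nonincreasing_of_derive (fun y => (u1 - w y) * exp (- a * y))); trivial.
    - intros x _. apply (continuous_mult (fun y => u1 - w y)).
      + apply (continuous_minus (fun _ => u1) w);
          [apply continuous_const|apply Hwc].
      + apply (ex_derive_continuous (fun y => exp (- a * y))). now auto_derive.
    - intros x Hx. eexists. split; [apply Hd; lra|].
      pose proof (flux_tangent_le u1 (w x)). fold a in H.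
      pose proof (exp_pos (- a * x)). nra. }
  rewrite Hw0, Rmult_0_r, exp_0, Rmult_1_r in H.
  replace (u1 - w y) with ((u1 - w y) * exp (- a * y) * exp (a * y)).
  - apply Rmult_le_compat_r; [apply Rlt_le, exp_pos|easy].
  - rewrite Rmult_assoc, <- exp_plus.
    replace (- a * y + a * y) with 0 by ring. rewrite exp_0. ring.
Qed.

(** * Comparison of the viscous solution with the layer profile *)

Section Comparison.

Variables (U w : R -> R) (d L : R).
Hypothesis L_ge_1 : 1 <= L.
Hypothesis d_ge_0 : 0 <= d.
Hypothesis U_continuous : forall y, continuous U y.
Hypothesis w_continuous : forall y, continuous w y.
Hypothesis U_0 : U 0 = u0.
Hypothesis U_L : U L = u1.
Hypothesis w_0 : w 0 = u0.
Hypothesis U_derive : forall y, 0 < y < L -> is_derive U y (f (U y) + (d - f u1)).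
Hypothesis w_derive : forall y, 0 < y -> is_derive w y (f (w y) - f u1).
Hypothesis U_range : forall y, 0 <= y <= L -> u0 <= U y <= u1.
Hypothesis w_range : forall y, 0 <= y -> u0 <= w y <= u1.

Lemma difference_continuous y : continuous (fun y => U y - w y) y.
Proof. apply (continuous_minus U w); easy. Qed.

Lemma difference_derive y :
  0 < y < L -> is_derive (fun y => U y - w y) y (f (U y) - f (w y) + d).
Proof.
  intros Hy.
  replace (f (U y) - f (w y) + d)
    with ((f (U y) + (d - f u1)) - (f (w y) - f u1)) by ring.
  apply (is_derive_minus U w); [now apply U_derive|now apply w_derive].
Qed.

(** Where [U < w <= 0], [f] decreasing gives [f(U) >= f(w)], so with [d >= 0] the difference cannot
    fall further. *)
Lemma difference_ge_0 y : 0 <= y <= L -> 0 <= U y - w y.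
Proof.
  intros Hy.
  assert (- (U y - w y) <= 0); [|lra].
  apply (barrier_le (fun y => - (U y - w y)) 0 y 0); [lra| |lra|].
  - intros x _. apply (continuous_opp (fun y => U y - w y)), difference_continuous.
  - intros x Hx Hneg.
    exists (- (f (U x) - f (w x) + d)). split.
    + apply (is_derive_opp (fun y => U y - w y)), difference_derive. lra.
    + pose proof (flux_decreasing (U x) (w x) ltac:(lra)
        ltac:(pose proof (w_range x ltac:(lra)); lra)). lra.
Qed.

(* A barrier of slope [d / (1 - f'(u0))] on [[L - 1, L]]. *)
Lemma defect_le : d <= (1 - Derive f u0) * (u1 - w L).
Proof.
  set (M := 1 - Derive f u0).
  assert (HM : 1 <= M).
  { unfold M. pose proof (flux_Derive_le u0 0 ltac:(lra)).
    rewrite f'_0 in H. lra. }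
  set (c := d / M).
  assert (Hc : c * M = d) by (unfold c; field; lra).
  assert (Hc0 : 0 <= c) by (apply Rdiv_le_0_compat; lra).
  assert (H : c * (L - (L - 1)) - (U L - w L) <= 0).
  { apply (barrier_le (fun y => c * (y - (L - 1)) - (U y - w y)) (L - 1) L 0);
      [lra| | |].
    - intros x _. apply (continuous_minus (fun y => c * (y - (L - 1))));
        [|apply difference_continuous].
      apply (ex_derive_continuous (fun y => c * (y - (L - 1)))). now auto_derive.
    - pose proof (difference_ge_0 (L - 1) ltac:(lra)). lra.
    - intros x Hx Hlt.
      exists (c - (f (U x) - f (w x) + d)). split.
      + apply (is_derive_minus (fun y => c * (y - (L - 1))));
          [auto_derive; [easy|ring]|apply difference_derive; lra].
      + pose proof (difference_ge_0 x ltac:(lra)) as Hz.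
        pose proof (flux_tangent_le (w x) (U x)) as Ht.
        pose proof (flux_Derive_le u0 (w x) ltac:(apply w_range; lra)) as Hf'.
        (* Below the barrier [z <= c], hence [z' >= f'(u0) z + d >= (1 - M) * c + d = c], the slope
           of the barrier. *)
        assert (Hzc : U x - w x <= c) by nra.
        assert ((1 - M) * c <= f (U x) - f (w x)); [|lra].
        apply Rle_trans with ((1 - M) * (U x - w x)); [nra|].
        apply Rle_trans with (Derive f (w x) * (U x - w x)); [|lra].
        apply Rmult_le_compat_r; unfold M; lra. }
  rewrite U_L in H. nra.
Qed.

(** The tangent at [U] gives [z' <= f'(U) z + d <= f'(u1) z + d], which is negative above the stated
    level. *)
Lemma difference_le_defect y :
  u1 < 0 -> 0 <= y <= L -> U y - w y <= d / - Derive f u1.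
Proof.
  intros Hu1 Hy.
  pose proof (flux_Derive_neg u1 Hu1) as Ha.
  assert (HB : 0 <= d / - Derive f u1) by (apply Rdiv_le_0_compat; lra).
  apply (barrier_le (fun y => U y - w y) 0 y); [lra| |lra|].
  - intros x _. apply difference_continuous.
  - intros x Hx Hlt.
    exists (f (U x) - f (w x) + d). split; [apply difference_derive; lra|].
    pose proof (flux_tangent_le (U x) (w x)) as Ht.
    pose proof (flux_Derive_le (U x) u1 ltac:(apply U_range; lra)) as Hf'.
    apply Rlt_div_l in Hlt; [|lra]. nra.
Qed.

Lemma difference_exponential_bound y :
  u1 < 0 -> 0 <= y <= L ->
  Rabs (U y - w y) <=
    (1 - Derive f u0) * (u1 - u0) / - Derive f u1 * exp (Derive f u1 * L).
Proof.
  intros Hu1 Hy.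
  rewrite Rabs_pos_eq by now apply difference_ge_0.
  apply Rle_trans with (1 := difference_le_defect y Hu1 Hy).
  pose proof (flux_Derive_neg u1 Hu1) as Ha.
  pose proof (layer_exponential_decay w L w_continuous w_0 w_derive ltac:(lra)).
  pose proof (flux_Derive_le u0 0 ltac:(lra)) as HM. rewrite f'_0 in HM.
  replace ((1 - Derive f u0) * (u1 - u0) / - Derive f u1 * exp (Derive f u1 * L))
    with ((1 - Derive f u0) * ((u1 - u0) * exp (Derive f u1 * L)) / - Derive f u1)
    by (field; lra).
  apply Rmult_le_compat_r; [apply Rlt_le, Rinv_0_lt_compat; lra|].
  apply Rle_trans with (1 := defect_le).
  apply Rmult_le_compat_l; lra.
Qed.

(** * The sonic case [u1 = 0] *)

Section Sonic.

Variable k : R.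
Hypothesis k_gt_0 : 0 < k.
Hypothesis u1_eq_0 : u1 = 0.
Hypothesis quadratic : forall p, 0 <= p <= - u0 -> k * p ^ 2 <= f (- p).
Hypothesis U_lt_u1 : forall y, 0 <= y < L -> U y < u1.

(* With [q = - U]: [(1 / q)' >= k] bounds [q (L / 2)] above, and [q' <= - d]
   with [q L = 0] bounds it below. *)
Lemma sonic_defect_le : d * k * L ^ 2 <= 4.
Proof.
  assert (HU' : forall y, 0 < y < L -> is_derive U y (f (U y) + d)).
  { intros y Hy. replace (f (U y) + d) with (f (U y) + (d - f u1)).
    - now apply U_derive.
    - rewrite u1_eq_0, f_0. ring. }
  assert (Hneg : forall y, 0 <= y < L -> U y < 0)
    by (intros; rewrite <- u1_eq_0; now apply U_lt_u1).
  assert (Hupper : - / U 0 - k * 0 <= - / U (L / 2) - k * (L / 2)).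
  { apply (nondecreasing_of_derive (fun y => - / U y - k * y)); [lra| |].
    - intros x Hx. specialize (Hneg x ltac:(lra)).
      apply (continuous_minus (fun y => - / U y) (fun y => k * y)).
      + apply (continuous_opp (fun y => / U y)).
        apply (continuous_comp U Rinv); [easy|].
        apply continuous_Rinv. lra.
      + apply (ex_derive_continuous (fun y => k * y)). now auto_derive.
    - intros x Hx. specialize (Hneg x ltac:(lra)).
      specialize (HU' x ltac:(lra)).
      exists ((f (U x) + d) / (U x) ^ 2 - k). split.
      + auto_derive.
        * repeat split; [|lra]. eexists; apply HU'.
        * change (fun x => U x) with U.
          rewrite (is_derive_unique _ _ _ HU'). field. lra.
      + pose proof (U_range x ltac:(lra)).
        pose proof (quadratic (- U x) ltac:(lra)) as Hq.
        rewrite Ropp_involutive in Hq.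
        assert (k <= (f (U x) + d) / U x ^ 2); [|lra].
        apply Rle_div_r; [apply pow2_gt_0; lra|].
        replace ((- U x) ^ 2) with (U x ^ 2) in Hq by ring. lra. }
  assert (Hlower : U (L / 2) - d * (L / 2) <= U L - d * L).
  { apply (nondecreasing_of_derive (fun y => U y - d * y)); [lra| |].
    - intros x _. apply (continuous_minus U (fun y => d * y)); [easy|].
      apply (ex_derive_continuous (fun y => d * y)). now auto_derive.
    - intros x Hx. exists (f (U x) + d - d). split.
      + apply (is_derive_minus U); [apply HU'; lra|]. auto_derive; [easy|ring].
      + pose proof (flux_ge_0 (U x)). lra. }
  pose proof (Hneg (L / 2) ltac:(lra)) as Hmid.
  pose proof (Rinv_lt_0_compat (U 0) (Hneg 0 ltac:(lra))).
  set (q := - U (L / 2)).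
  assert (Hq : 0 < q) by (unfold q; lra).
  assert (Hdq : d * (L / 2) <= q) by (unfold q; lra).
  assert (Hkq : k * (L / 2) <= / q) by (unfold q; rewrite Rinv_opp; lra).
  (* Multiplying the lower bound on [q] by that on [/ q] eliminates the unknown midpoint value. *)
  assert (Hprod : d * (L / 2) * (k * (L / 2)) <= q * / q)
    by (apply Rmult_le_compat; nra).
  rewrite Rinv_r in Hprod by lra. lra.
Qed.

Lemma difference_sonic_bound y :
  0 <= y <= L -> Rabs (U y - w y) <= 2 / k * / L.
Proof.
  intros Hy.
  rewrite Rabs_pos_eq by now apply difference_ge_0.
  set (B := 2 / k * / L).
  assert (HB : 0 < B).
  { apply Rmult_lt_0_compat; [apply Rdiv_lt_0_compat|apply Rinv_0_lt_compat]; lra. }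
  (* [B] is chosen so that [k * B ^ 2 = 4 / (k * L ^ 2)], the bound on the defect; above [B] the
     damping [k z^2] then absorbs [d]. *)
  assert (HdB : d <= k * B ^ 2).
  { replace (k * B ^ 2) with (4 / (k * L ^ 2)) by (unfold B; field; lra).
    apply Rle_div_r; [apply Rmult_lt_0_compat; [|apply pow_lt]; lra|].
    pose proof sonic_defect_le. lra. }
  apply (barrier_le (fun y => U y - w y) 0 y); [lra| |lra|].
  - intros x _. apply difference_continuous.
  - intros x Hx Hlt.
    exists (f (U x) - f (w x) + d). split; [apply difference_derive; lra|].
    pose proof (U_lt_u1 x ltac:(lra)) as HUx.
    pose proof (w_range x ltac:(lra)) as Hwx.
    (* Splitting [- w = - U + z] gives [f(U) - f(w) <= - f(- z)]. *)
    pose proof (flux_superadditive (- U x) (U x - w x) ltac:(lra) ltac:(lra)) as Hs.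
    replace (- (- U x + (U x - w x))) with (w x) in Hs by ring.
    rewrite Ropp_involutive in Hs.
    pose proof (quadratic (U x - w x) ltac:(lra)).
    assert (B ^ 2 <= (U x - w x) ^ 2) by (apply pow_incr; lra). nra.
Qed.

End Sonic.

End Comparison.

End ConvexFlux.

(** * The estimates in the original variable *)

Theorem theorem3p12 :
  forall (f : R -> R) (u0 u1 : R) (uhat : R -> R -> R) (v : R -> R),
    C2 f -> strictly_convex f -> f 0 = 0 -> Derive f 0 = 0 ->
    u0 < u1 -> u1 <= 0 ->
    (forall eps, 0 < eps <= 1 -> viscous_bvp_solution f u0 u1 eps (uhat eps)) ->
    layer_profile_solution f u0 u1 v ->
    exists C : R, 0 < C /\
      forall eps x : R, 0 < eps <= 1 -> 0 <= x <= 1 ->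
        (u1 < 0 ->
           Rabs (uhat eps x - u1 - v (x / eps)) <= C * exp (Derive f u1 / eps)) /\
        (u1 = 0 -> Derive_n f 2 0 <> 0 ->
           Rabs (uhat eps x - v (x / eps)) <= C * eps).
Proof.
  intros f u0 u1 uhat v HC2 Hconv Hf0 Hf'0 H01 H10 Hu Hv.
  destruct (layer_first_integral f HC2 Hconv Hf'0 u0 u1 H01 H10 v Hv)
    as [w [Hwc [Hw0 [Hwv [Hwd Hwr]]]]].
  assert (Hlt1 : forall eps, 0 < eps <= 1 -> 1 <= / eps).
  { intros eps Heps. rewrite <- Rinv_1. apply Rinv_le_contravar; lra. }
  assert (Hstretch : forall eps x, 0 < eps <= 1 -> 0 <= x <= 1 ->
    0 <= x / eps <= / eps /\ eps * (x / eps) = x).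
  { intros eps x Heps Hx. pose proof (Hlt1 eps Heps).
    unfold Rdiv. repeat split; [nra|nra|field; lra]. }
  destruct H10 as [H10|H10].
  - pose proof (flux_Derive_neg f HC2 Hconv Hf0 Hf'0 u1 H10) as Ha.
    pose proof (flux_Derive_neg f HC2 Hconv Hf0 Hf'0 u0 ltac:(lra)) as HM.
    exists ((1 - Derive f u0) * (u1 - u0) / - Derive f u1). split.
    { apply Rdiv_lt_0_compat; nra. }
    intros eps x Heps Hx. split; [intros _|lra].
    destruct (Hstretch eps x Heps Hx) as [Hy Hyx].
    destruct (viscous_first_integral f HC2 u0 u1 H01
      eps (uhat eps) ltac:(lra) (Hu eps Heps))
      as [U [d [Hd [HUc [HU0 [HUL [HUu [HUd [HUr HUlt]]]]]]]]].
    replace (uhat eps x - u1 - v (x / eps)) with (U (x / eps) - w (x / eps))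
      by (rewrite HUu, Hyx, Hwv by lra; ring).
    apply (difference_exponential_bound f HC2 Hconv Hf0 Hf'0 u0 u1)
      with (d := d) (L := / eps); try assumption; try lra.
    now apply Hlt1.
  - destruct (Req_dec (Derive_n f 2 0) 0) as [Hf2|Hf2].
    (* With [u1 = 0] and [f''(0) = 0] both claims are vacuous, so any positive constant serves. *)
    { exists 1. split; [lra|]. intros eps x _ _. split; [lra|easy]. }
    destruct (flux_quadratic_lower_bound f HC2 Hconv Hf0 Hf'0 (- u0)
      ltac:(lra) Hf2) as [k [Hk Hquad]].
    exists (2 / k). split; [apply Rdiv_lt_0_compat; lra|].
    intros eps x Heps Hx. split; [lra|intros _ _].
    destruct (Hstretch eps x Heps Hx) as [Hy Hyx].
    destruct (viscous_first_integral f HC2 u0 u1 H01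
      eps (uhat eps) ltac:(lra) (Hu eps Heps))
      as [U [d [Hd [HUc [HU0 [HUL [HUu [HUd [HUr HUlt]]]]]]]]].
    replace (uhat eps x - v (x / eps)) with (U (x / eps) - w (x / eps))
      by (rewrite HUu, Hyx, Hwv by lra; lra).
    (* Writes the factor [eps] of the bound as [/ L] with [L = / eps]. *)
    rewrite <- (Rinv_inv eps) at 3.
    apply (difference_sonic_bound f HC2 Hconv Hf0 Hf'0 u0 u1)
      with (d := d); try assumption; try lra.
    now apply Hlt1.
Qed.
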